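(* Let $r\geq 2$ be an integer and let $\xi\in\{1,2,\dots,r\}$. Let $s=r^2+r+\xi$ and $t=r^3+r^2+\xi(r+1)$. Then $\mu\left(3;\frac{s}{t}\right)\leq t$, i.e. $\mu\left(3;\frac st\right)$ is smaller than the upper bound $\left\lceil \frac ts\left\lceil \frac ts\right\rceil\right\rceil\cdot\left\lceil\frac ts\right\rceil$.
   Context: For a positive integer $d$ and a real $\varepsilon\in(0,1)$, let $T^d=[\mathbb{R}/\mathbb{Z}]^d$ be the $d$-dimensional torus. An $\varepsilon$-sub-cube of $T^d$ is a set of the form $\{(x_1,\ldots,x_d): x_i\in[x_i^0,x_i^0+\varepsilon] \text{ for all } i\}$, where $x_1^0,\dots,x_d^0\in\mathbb{R}/\mathbb{Z}$ and $[x_i^0,x_i^0+\varepsilon]$ denotes the image in $\mathbb{R}/\mathbb{Z}$ of the corresponding closed real interval of length $\varepsilon$. $\mu(d;\varepsilon)$ denotes the minimum number of $\varepsilon$-sub-cubes whose union is $T^d$. *)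

(* Defs.v *)
From HB Require Import structures.
From mathcomp Require Import all_boot all_order all_algebra generic_quotient.
From mathcomp Require Import lra.
From mathcomp Require Import boolp classical_sets cardinality reals.
Set Implicit Arguments.
Unset Strict Implicit.
Unset Printing Implicit Defensive.
Import Order.TTheory GRing.Theory Num.Theory.
Local Open Scope classical_set_scope.
Local Open Scope ring_scope.
Local Open Scope quotient_scope.
Local Open Scope card_scope.

Section Torus.
Context (R : realType).

Definition eqmod1 (x y : R) : bool := x - y \is a Num.int.

Lemma eqmod1_refl : reflexive eqmod1.
Proof. by move=> x; rewrite /eqmod1 subrr rpred0. Qed.

Lemma eqmod1_sym : symmetric eqmod1.
Proof. by move=> x y; rewrite /eqmod1 -opprB rpredN. Qed.

Lemma eqmod1_trans : transitive eqmod1.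
Proof.
move=> y x z xy yz; rewrite /eqmod1.
by rewrite -(subrK y x) -addrA rpredD.
Qed.

Canonical eqmod1_equiv := EquivRel eqmod1 eqmod1_refl eqmod1_sym eqmod1_trans.

Definition circle := {eq_quot eqmod1}.

(* The lift [repr c] of [c] is irrelevant, see [arc_pi]. *)
Definition arc (c : circle) (eps : R) : set circle :=
  [set \pi_circle x | x in [set x | repr c <= x <= repr c + eps]].

Lemma arc_pi (a eps : R) :
  arc (\pi_circle a) eps = [set \pi_circle x | x in [set x | a <= x <= a + eps]].
Proof.
set b := repr (\pi_circle a).
have ab : a - b \is a Num.int.
  apply: (introT (@eqmodP _ eqmod1_equiv _ _)).
  by rewrite /b reprK.
rewrite /arc -/b; apply/seteqP; split=> _ [x /= /andP[h1 h2] <-].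
- exists (x + (a - b)).
    by apply/andP; split; lra.
  apply/eqmodP; rewrite /= /eqmod1 addrAC subrr add0r //.
- exists (x - (a - b)).
    by apply/andP; split; lra.
  apply/eqmodP; rewrite /= /eqmod1 addrAC subrr add0r rpredN //.
Qed.

Definition torus (d : nat) := 'I_d -> circle.

Definition subcube (d : nat) (eps : R) (Q : set (torus d)) : Prop :=
  exists x0 : torus d, Q = [set x | forall i, arc (x0 i) eps (x i)].

Definition covered_by (d : nat) (eps : R) (n : nat) : Prop :=
  exists C : set (set (torus d)),
    [/\ C #= `I_n, C `<=` subcube eps & \bigcup_(Q in C) Q = setT].

Lemma covered_by_some (d : nat) (eps : R) :
  0 < eps -> exists n, covered_by d eps n.
Proof.
move=> e0.
pose N := (Num.truncn eps^-1).+1.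
have Ne : 1 < N%:R * eps.
  rewrite -ltr_pdivrMr // div1r /N; apply: proj2 (andP (truncn_itv _)).
  by rewrite invr_ge0 ltW.
pose K k := \pi_circle (k%:R * eps).
have cov (p : circle) : exists k : 'I_N, arc (K k) eps p.
  pose y := repr p - (Num.floor (repr p))%:~R.
  have y0 : 0 <= y by rewrite subr_ge0 floor_le.
  have y1 : y < 1 by have := floorD1_gt (repr p); rewrite intrD /y; lra.
  have yp : \pi_circle y = p.
    rewrite -[RHS]reprK; apply/eqmodP.
    by rewrite /= /eqmod1 /y addrAC subrr add0r rpredN intr_int.
  have /andP[k1 k2] := truncn_itv (divr_ge0 y0 (ltW e0)).
  have kN : (Num.truncn (y / eps) < N)%N.
    rewrite -(ltr_nat R); apply: le_lt_trans k1 _.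
    by rewrite ltr_pdivrMr //; apply: lt_trans Ne.
  exists (Ordinal kN); rewrite /K arc_pi; exists y => //=.
  apply/andP; split; first by rewrite -ler_pdivlMr.
  by move: k2; rewrite ltr_pdivrMr // -natr1 mulrDl mul1r => /ltW.
pose cube (f : {ffun 'I_d -> 'I_N}) : set (torus d) :=
  [set x | forall i, arc (K (f i)) eps (x i)].
have [n Cn] : exists n, range cube #= `I_n.
  by apply/finite_setP/finite_image/finite_finset.
exists n, (range cube); split=> //.
  by move=> _ [f _ <-]; exists (fun i => K (f i)).
apply/seteqP; split=> // x _.
have [f fP] := choice (fun i => cov (x i)).
exists (cube (finfun f)); first by exists (finfun f).
by move=> i; rewrite ffunE.
Qed.

Lemma covered_by_ex (d : nat) (eps : R) :
  (exists n, covered_by d eps n) -> exists n, `[< covered_by d eps n >].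
Proof. by case=> n nP; exists n; apply/asboolP. Qed.

(* The default value 0 is never taken when [0 < eps], see [muP]. *)
Definition mu (d : nat) (eps : R) : nat :=
  if pselect (exists n, covered_by d eps n) is left h
  then ex_minn (covered_by_ex h) else 0%N.

Lemma muP (d : nat) (eps : R) : 0 < eps ->
  covered_by d eps (mu d eps) /\
  forall n, covered_by d eps n -> (mu d eps <= n)%N.
Proof.
move=> /(covered_by_some d) h; rewrite /mu; case: pselect => // h'.
case: ex_minnP => m /asboolP mP mmin; split=> // n nP.
by apply: mmin; apply/asboolP.
Qed.

End Torus.

(* Main.v *)
Require Import Defs.
From mathcomp Require Import all_boot all_order all_algebra reals.
From mathcomp Require Import generic_quotient boolp classical_sets functions.
From mathcomp Require Import cardinality zify ring lra.
Import Order.TTheory GRing.Theory Num.Theory.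
Local Open Scope ring_scope.
Local Open Scope card_scope.
Local Open Scope quotient_scope.

(** Scale the torus by t, so that it becomes (R/tZ)^3 and the cubes get side s.
Rounding down shows that cubes with integral corners cover as soon as they
cover the integral points, that is (Z/tZ)^3 ([mu_le_of_grid_cover]).  The
covering is by a lattice: the corners are the t multiples of (1, r, b) in
(Z/tZ)^3, with b = r^2 + r + 1.  Note that t = r s + xi = (r + 1)(r^2 + xi).

Fix the first coordinate of a point.  The cubes that reach it there are those
of s consecutive multiples, so the claim is that for s consecutive values of
k, which may be taken to be 0, ..., s - 1, the squares of side s with corners
(r k, b k) cover (Z/tZ)^2 ([plane_cover]).

Fix now the second coordinate y.  Since the s steps of length r go almost once
around the circle of length t = r s + xi, the squares that reach y include
those of r + 1 values of k that are consecutive modulo s: k = q, q - 1, ...,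
q - r with q close to y / r, where s is added to the negative ones
([column_start]).  It remains to see that the intervals of length s that start
at the points b k cover the circle, that is, that consecutive points are at
most s apart.
- If no k is shifted by s, the gaps are b <= s and, the last one,
  t - r b = xi (r + 1) - r <= s.
- The shift by s moves a point by b s, which is delta = r (r + 1 - xi) >= 0
  modulo t.  This makes one of the gaps b smaller, and the last one becomes
  t + delta - r b = r^2 + xi <= s.
So r + 1 intervals always suffice.  A discrete intermediate value argument
([first_crossing]) finds the interval that contains a given point.

For the comparison with the iterated ceiling, t / s > r gives the lower bounds
r + 1 and r (r + 1) + 1 for the two ceilings, whose product exceeds t
([iterated_ceil_bound_gt]). *)

(** * Remainders and discrete intermediate values *)

Lemma modz_lt (n u s t : int) : s <= t -> 0 <= n - u * t < s -> (n %% t)%Z < s.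
Proof.
move=> st /andP[n0 ns]; rewrite -(subrK (u * t) n) addrC modzMDl modz_small //.
by rewrite n0 (lt_le_trans ns st).
Qed.

(** Discrete intermediate values: a sequence with increments at most b that
starts below t and reaches t cannot jump over [t, t + b). *)
Lemma first_crossing (f : nat -> int) (n : nat) (t b : int) :
  f 0%N < t -> t <= f n -> (forall i, f i.+1 <= f i + b) ->
  exists2 i, (i <= n)%N & t <= f i < t + b.
Proof.
move=> f0 fn fS.
have ex : exists i, t <= f i by exists n.
case: (ex_minnP ex) => -[|i] ti imin; first by rewrite leNgt f0 in ti.
exists i.+1; first exact: imin.
rewrite ti /=; apply: le_lt_trans (fS i) _; rewrite ltrD2r ltNge.
by apply/negP => /imin; rewrite ltnn.
Qed.

(** * The lattice covering of (Z/tZ)^3 *)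

(** The start of the r + 1 columns that reach height y: going down from q by at
most r steps keeps y - r k in [0, s).  The last clause gives the room for an
additional xi when some k wrap around, as r s = t - xi. *)
Lemma column_start (r x s y : nat) : (0 < r)%N -> (r < s)%N ->
  (y < r * s + x)%N ->
  exists q, [/\ (q < s)%N, (r * q <= y)%N, (y < r * q + r + x)%N
              & ((q < r)%N -> (y < r * q + r)%N)].
Proof.
move=> r0 rs yt; have ydiv := divn_eq y r; have ymod := ltn_pmod y r0.
have [qs|qs] := ltnP (y %/ r)%N s.
  by exists (y %/ r)%N; split; [| nia | nia | nia].
(* The multiple r * s of r may still be at most y, but k = s is out of range:
   the start is then clamped to s - 1. *)
exists s.-1; split; [lia| | |lia].
  have : (r * s <= r * (y %/ r))%N by rewrite leq_mul2l qs orbT.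
  nia.
have -> : (r * s.-1 + r = r * s)%N by rewrite -mulnSr prednK //; lia.
by [].
Qed.

(** The planar covering behind the lattice: only the squares in the r + 1
columns given by [column_start] are used, and the gaps between their bottoms
are at most s. *)
Lemma plane_cover (r x s t b : nat) (y z : int) :
  (0 < r)%N -> (0 < x <= r)%N -> s = (r ^ 2 + r + x)%N -> t = (r * s + x)%N ->
  b = (r ^ 2 + r + 1)%N ->
  exists k : nat, [/\ (k < s)%N, ((y - r%:Z * k%:Z) %% t%:Z)%Z < s%:Z
     & ((z - b%:Z * k%:Z) %% t%:Z)%Z < s%:Z].
Proof.
move=> r0 /andP[x0 xr] sE tE bE.
have st : s%:Z <= t%:Z by rewrite lez_nat tE; nia.
have sZ : s%:Z = r%:Z * r%:Z + r%:Z + x%:Z by rewrite sE -mulnn; lia.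
have tZ : t%:Z = r%:Z * s%:Z + x%:Z by rewrite tE; lia.
have bZ : b%:Z = r%:Z * r%:Z + r%:Z + 1 by rewrite bE -mulnn; lia.
have t0 : t%:Z != 0 by lia.
have rs : (r < s)%N by nia.
have bs : b%:Z <= s%:Z by lia.
pose Y := `|(y %% t%:Z)%Z|%N.
have YE : y = (y %/ t%:Z)%Z * t%:Z + Y%:Z.
  by rewrite /Y gez0_abs ?modz_ge0 // -divz_eq.
have Yt : (Y < r * s + x)%N.
  by rewrite -tE -ltz_nat /Y gez0_abs ?modz_ge0 // ltz_pmod // lt_def t0.
have [q [qs qY Yq Yq']] := column_start r x s Y r0 rs Yt.
set y1 := (y %/ t%:Z)%Z in YE.
pose w := ((z - b%:Z * q%:Z) %% t%:Z)%Z.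
have w0 : 0 <= w by rewrite modz_ge0.
have wt : w < t%:Z by rewrite ltz_pmod // lt_def t0.
have [z1 zE] : exists z1, z = z1 * t%:Z + w + b%:Z * q%:Z.
  exists ((z - b%:Z * q%:Z) %/ t%:Z)%Z.
  by rewrite -divz_eq subrK.
pose delta : int := r%:Z * (r%:Z + 1 - x%:Z).
have delta0 : 0 <= delta by rewrite mulr_ge0 //; lia.
(* Going once around the s columns moves the multiples of b by delta mod t. *)
have bsE : b%:Z * s%:Z = (r%:Z + 1) * t%:Z + delta.
  by rewrite /delta tZ bZ sZ; ring.
(* k i runs down from q, cyclically modulo s; f i lifts z - b * k i. *)
pose k i := if (i <= q)%N then (q - i)%N else (q + s - i)%N.
pose f i : int := w + b%:Z * i%:Z - (if (i <= q)%N then 0 else delta).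
have [i ir [v fi]] : exists2 i, (i <= r)%N &
    exists v : int, 0 <= f i - v * t%:Z < s%:Z.
  have [ws|sw] := ltP w s%:Z.
    by exists 0%N => //; exists 0; rewrite /f leq0n; lia.
  have [| |n|i ir fi] := first_crossing f r t%:Z b%:Z.
  - by rewrite /f leq0n; lia.
  - rewrite /f.
    suff : t%:Z <= w + b%:Z * r%:Z - delta by case: ifP => _; lia.
    have : t%:Z + delta = b%:Z * r%:Z + (r%:Z * r%:Z + x%:Z).
      by rewrite /delta tZ bZ sZ; ring.
    have : r%:Z * r%:Z + x%:Z <= s%:Z by rewrite sE; nia.
    lia.
  - rewrite /f -[n.+1]addn1 PoszD mulrDr mulr1; case: ifP => h1; case: ifP => h2; lia.
  by exists i => //; exists 1; lia.
have iq : (i <= q + s)%N by lia.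
exists (k i); rewrite /k; split.
- by case: ifP; lia.
- have ri0 : 0 <= r%:Z * i%:Z by rewrite mulr_ge0.
  have ri : r%:Z * i%:Z <= r%:Z * r%:Z by rewrite ler_wpM2l // lez_nat.
  case: (leqP i q) => [iq'|qi].
    apply: (@modz_lt _ y1) => //.
    have -> : y - r%:Z * (q - i)%N%:Z - y1 * t%:Z
        = Y%:Z - r%:Z * q%:Z + r%:Z * i%:Z by rewrite YE -subzn //; ring.
    by lia.
  have {}Yq' : (Y < r * q + r)%N by apply: Yq'; lia.
  apply: (@modz_lt _ (y1 - 1)) => //.
  have -> : y - r%:Z * (q + s - i)%N%:Z - (y1 - 1) * t%:Z
      = Y%:Z - r%:Z * q%:Z + r%:Z * i%:Z + x%:Z.
    by rewrite YE tZ -subzn // PoszD; ring.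
  by lia.
- move: fi; rewrite /f; case: (leqP i q) => [iq'|qi] fi.
    apply: (@modz_lt _ (z1 + v)) => //.
    suff -> : z - b%:Z * (q - i)%N%:Z - (z1 + v) * t%:Z
      = w + b%:Z * i%:Z - 0 - v * t%:Z by [].
    by rewrite zE -subzn //; ring.
  apply: (@modz_lt _ (z1 + v - (r%:Z + 1))) => //.
  suff -> : z - b%:Z * (q + s - i)%N%:Z - (z1 + v - (r%:Z + 1)) * t%:Z
      = w + b%:Z * i%:Z - delta - v * t%:Z by [].
  rewrite zE -subzn // PoszD mulrBr mulrDr bsE; ring.
Qed.

(** The planar covering applies along the first coordinate: the index of the cube
is found by subtracting the point whose first coordinate makes the range of
admissible multiples equal to 0, ..., s - 1. *)
Lemma space_cover (r x s t b : nat) (X : 'I_3 -> int) :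
  (0 < r)%N -> (0 < x <= r)%N -> s = (r ^ 2 + r + x)%N -> t = (r * s + x)%N ->
  b = (r ^ 2 + r + 1)%N ->
  exists j : 'I_t, forall i : 'I_3,
    ((X i - nth 0 [:: 1; r%:Z; b%:Z] i * j%:Z) %% t%:Z)%Z < s%:Z.
Proof.
move=> r0 x_itv sE tE bE.
have t0 : (0 < t)%N by lia.
have st : s%:Z <= t%:Z by rewrite lez_nat tE; nia.
pose X0 := X 0 - s%:Z + 1.
have [k [ks ky kz]] := plane_cover r x s t b (X 1 - r%:Z * X0)
  (X 2%:R - b%:Z * X0) r0 x_itv sE tE bE.
pose J := X0 + k%:Z.
have J0 : 0 <= (J %% t%:Z)%Z by rewrite modz_ge0 //; lia.
have Jt : (`|(J %% t%:Z)%Z| < t)%N.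
  by rewrite -ltz_nat gez0_abs // ltz_pmod.
exists (Ordinal Jt) => i; rewrite [Ordinal Jt : nat]/= gez0_abs //.
set a := nth _ _ _.
have -> : ((X i - a * (J %% t%:Z)%Z) %% t%:Z)%Z = ((X i - a * J) %% t%:Z)%Z.
  rewrite {2}(divz_eq J t%:Z).
  rewrite -(modzMDl (- a * (J %/ t%:Z)%Z) (X i - a * (J %% t%:Z)%Z)).
  by congr (_ %% _)%Z; ring.
case: i @a => -[|[|[|//]]] lti /=.
- apply: (@modz_lt _ 0) => //; rewrite (_ : Ordinal lti = 0); last exact: val_inj.
  by rewrite /J /X0; lia.
- rewrite (_ : Ordinal lti = 1); last exact: val_inj.
  by rewrite /J mulrDr opprD addrA.
rewrite (_ : Ordinal lti = 2%:R); last exact: val_inj.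
by rewrite /J mulrDr opprD addrA.
Qed.

(** * From grid points to the torus *)

(** In coordinates scaled by t, an integral point in a half-open integral cube
has its whole unit cell in the closed real cube, so a covering of the points of
(Z/tZ)^d covers the torus.  The cubes of the family may coincide, hence the
passage to the cardinal of its range. *)
Lemma mu_le_of_grid_cover (R : realType) (d n s t : nat)
    (c : 'I_n -> 'I_d -> int) : (0 < s)%N -> (0 < t)%N ->
  (forall X : 'I_d -> int, exists j, forall i,
     ((X i - c j i) %% t%:Z)%Z < s%:Z) ->
  (mu d (s%:R / t%:R : R) <= n)%N.
Proof.
move=> s0 t0 ccover; set eps : R := s%:R / t%:R.
have tR : 0 < t%:R :> R by rewrite ltr0n.
pose cube j : set (torus R d) :=
  [set x | forall i, Defs.arc (\pi_(circle R) ((c j i)%:~R / t%:R)) eps (x i)]%classic.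
have [m Cm] : exists m, range cube #= `I_m.
  by apply/finite_setP/finite_image/finite_finset.
have mn : (m <= n)%N.
  rewrite -card_le_II -(card_le_eql Cm).
  apply: card_le_trans (card_image_le _ _) _.
  by rewrite (card_le_eqr (@card_II n)).
apply: leq_trans mn; apply: (muP d _).2; first by rewrite divr_gt0 ?ltr0n.
exists (range cube); split=> //.
  by move=> _ [j _ <-]; eexists.
apply/seteqP; split=> // p _.
have [j jP] := ccover (fun i => Num.floor (repr (p i) * t%:R)).
exists (cube j) => // i; rewrite arc_pi.
have := jP i; set z := repr (p i); set X := Num.floor _; set a := c j i => Xa.
have zX : X%:~R <= z * t%:R by apply: floor_le.
have zX1 : z * t%:R < X%:~R + 1 by have := floorD1_gt (z * t%:R); rewrite intrD.
set u := ((X - a) %/ t%:Z)%Z; set m' := ((X - a) %% t%:Z)%Z in Xa.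
have XE : X%:~R = u%:~R * t%:R + m'%:~R + a%:~R :> R.
  by rewrite -[X](subrK a) intrD {1}(divz_eq (X - a) t%:Z) intrD intrM.
have m0 : 0 <= m'%:~R :> R by rewrite ler0z modz_ge0 //; lia.
have ms : m'%:~R + 1 <= s%:R :> R.
  by rewrite -[s%:R]/(s%:Z%:~R) -[1]/(1%:~R) -intrD ler_int; lia.
exists (z - u%:~R).
  rewrite /= /eps -mulrDl ler_pdivrMr // ler_pdivlMr // mulrBl.
  by apply/andP; split; lra.
rewrite -[RHS]reprK; apply/eqmodP.
by rewrite /= /eqmod1 -/z addrAC subrr add0r rpredN intr_int.
Qed.

(** * Comparison with the iterated ceiling *)

Lemma iterated_ceil_bound_gt (R : realType) (r xi s t : nat)
    (hxi : (1 <= xi <= r)%N)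
    (hs : s = (r ^ 2 + r + xi)%N)
    (ht : t = (r * s + xi)%N) :
  forall u : R, u = t%:R / s%:R ->
  t%:Z < Num.ceil (u * (Num.ceil u)%:~R) * Num.ceil u.
Proof.
move=> u uE.
have s0 : (0 < s)%N by nia.
have sR : 0 < s%:R :> R by rewrite ltr0n.
have ur : r%:R < u by rewrite uE ltr_pdivlMr // -natrM ltr_nat; lia.
have c1 : r%:Z + 1 <= Num.ceil u by rewrite lezD1 ceil_gt_int.
have c2 : r%:Z * (r%:Z + 1) + 1 <= Num.ceil (u * (Num.ceil u)%:~R).
  rewrite lezD1 ceil_gt_int intrM.
  apply: lt_le_trans (_ : u * (r%:Z + 1)%:~R <= _).
    by rewrite ltr_pM2r // ltr0z; lia.
  by rewrite ler_pM2l ?ler_int // (le_lt_trans _ ur).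
have : t%:Z < (r%:Z * (r%:Z + 1) + 1) * (r%:Z + 1).
  rewrite ht PoszD PoszM hs -mulnn; nia.
move/lt_le_trans; apply; apply: ler_pM => //; lia.
Qed.

Theorem theorem4 (R : realType) (r xi s t : nat)
    (hr : (2 <= r)%N) (hxi : (1 <= xi <= r)%N)
    (hs : s = (r ^ 2 + r + xi)%N)
    (ht : t = (r ^ 3 + r ^ 2 + xi * (r + 1))%N) :
  let eps : R := s%:R / t%:R in
  let u : R := t%:R / s%:R in
  (mu 3 eps <= t)%N /\
  (mu 3 eps)%:Z < Num.ceil (u * (Num.ceil u)%:~R) * Num.ceil u.
Proof.
move=> eps u.
have tE : t = (r * s + xi)%N by rewrite ht hs !expnS expn0; nia.
have mu_t : (mu 3 eps <= t)%N.
  apply: (mu_le_of_grid_cover R 3 t s t (fun j i =>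
    nth 0 [:: 1; r%:Z; (r ^ 2 + r + 1)%N%:Z] i * j%:Z)) => [||X]; [lia|lia|].
  by apply: (space_cover r xi) => //; lia.
split=> //; apply: le_lt_trans (_ : t%:Z < _); first by rewrite lez_nat.
exact: (iterated_ceil_bound_gt R r xi s t hxi hs tE u erefl).
Qed.
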